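(* Let $u_2=\phi(u,u_1)$ be an autonomous second-order ODE, with $\phi$ smooth on an open set $U\subseteq J^1(\mathbb R,\mathbb R)$, and let $(M,g)$ be its associated 3-dimensional Riemannian manifold. Let $f:I\to\mathbb R$ be a smooth function on an open interval $I\subseteq\mathbb R$ whose first-order prolongation $\mathrm{j}^1 f$ is a curve in $M$. If $f$ is a solution of $u_2=\phi(u,u_1)$, that is, $f''(x)=\phi(f(x),f'(x))$ for all $x\in I$, then the curve $\mathrm{j}^1 f$ is a geodesic of $(M,g)$.
   Context: $J^1(\mathbb R,\mathbb R)$ is the first-order jet bundle, identified with $\mathbb R^3$ with standard coordinates $(x,u,u_1)$, where $x$ is the independent variable, $u$ the dependent variable and $u_1$ the first derivative. The function $\phi$ is smooth on an open subset $U\subseteq J^1(\mathbb R,\mathbb R)$ and depends only on $(u,u_1)$. The 3-dimensional Riemannian manifold associated with the ODE $u_2=\phi(u,u_1)$ is $M=\{(x,u,u_1)\in U: u_1\neq 0\}$ with the Riemannian metric $$g=(1 + u_1^2)\, dx^2 - 2 u_1\, dx\, du + \left( 1 + \frac{\phi^2}{u_1^2} \right) du^2 - 2 \frac{\phi}{u_1}\, du\, du_1 + du_1^2 .$$ Equivalently, $g=\omega^1\otimes\omega^1+\omega^2\otimes\omega^2+\omega^3\otimes\omega^3$ with $\omega^1=dx$, $\omega^2=-u_1\,dx+du$, $\omega^3=-\frac{\phi}{u_1}\,du+du_1$. The first-order prolongation of a smooth function $f:I\to\mathbb R$ is the curve $(\mathrm{j}^1 f)(x)=(x,f(x),f'(x))$,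 $x\in I$. A curve $\gamma$ in $M$ is a geodesic if $\nabla_{\dot\gamma(t)}\dot\gamma(t)=0$ for every $t$, where $\nabla$ is the Levi-Civita connection of $g$. *)

(* Defs.v *)
From HB Require Import structures.
From mathcomp Require Import all_boot all_order all_algebra.
From mathcomp Require Import all_classical all_reals all_analysis.
From mathcomp Require Import ring.

Set Implicit Arguments.
Unset Strict Implicit.
Unset Printing Implicit Defensive.

Import Order.TTheory GRing.Theory Num.Theory.
Import numFieldNormedType.Exports.

Local Open Scope classical_set_scope.
Local Open Scope ring_scope.

(** * Smooth maps *)

(** [f] is infinitely differentiable at the points of [I]; only meant for [I]
    open, since the derivatives are taken in [R]. *)
Definition smooth_curve_on (R : realType) (V : normedModType R)
    (I : set R) (f : R -> V) : Prop :=
  forall (k : nat) (t : R), I t -> derivable (derive1n k f) t 1.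

Definition basis_vec (R : realType) (n : nat) (i : 'I_n.+1) : 'rV[R]_n.+1 :=
  delta_mx 0 i.

Definition iter_partial (R : realType) (n : nat) (V : normedModType R)
    (s : seq 'I_n.+1) (f : 'rV[R]_n.+1 -> V) : 'rV[R]_n.+1 -> V :=
  foldr (fun i (h : 'rV[R]_n.+1 -> V) => fun p => 'D_(basis_vec R i) h p) f s.

(** All iterated partial derivatives exist and are continuous at the points of
    [A]; as above, only meant for [A] open. The values of [f] off [A] are
    irrelevant. *)
Definition smooth_on (R : realType) (n : nat) (V : normedModType R)
    (A : set 'rV[R]_n.+1) (f : 'rV[R]_n.+1 -> V) : Prop :=
  forall (s : seq 'I_n.+1) (p : 'rV[R]_n.+1), A p ->
    {for p, continuous (iter_partial s f)} /\
    (forall i : 'I_n.+1, derivable (iter_partial s f) p (basis_vec R i)).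

(** * Riemannian geometry on an open subset [M] of R^(n+1)

    Functions and vector fields on [M] are represented by total functions on
    the ambient space, of which only the restriction to [M] matters. A metric
    is given by its Gram matrix in the standard coordinates. *)

Definition vector_field (R : realType) (n : nat) : Type :=
  'rV[R]_n.+1 -> 'rV[R]_n.+1.

Definition metric_tensor (R : realType) (n : nat) : Type :=
  'rV[R]_n.+1 -> 'M[R]_n.+1.

Definition inner (R : realType) (n : nat) (g : metric_tensor R n)
    (p v w : 'rV[R]_n.+1) : R :=
  (v *m g p *m w^T) 0 0.

Definition lie_bracket (R : realType) (n : nat) (X Y : vector_field R n) :
    vector_field R n :=
  fun p => 'D_(X p) Y p - 'D_(Y p) X p.

Record affine_connection (R : realType) (n : nat) (M : set 'rV[R]_n.+1)
    (nabla : vector_field R n -> vector_field R n -> vector_field R n) : Prop :=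
  AffineConnection {
    connection_smooth : forall X Y : vector_field R n,
      smooth_on M X -> smooth_on M Y -> smooth_on M (nabla X Y);
    connection_addl : forall X1 X2 Y : vector_field R n,
      smooth_on M X1 -> smooth_on M X2 -> smooth_on M Y ->
      forall p, M p ->
        nabla (fun q => X1 q + X2 q) Y p = nabla X1 Y p + nabla X2 Y p;
    connection_scalel : forall (h : 'rV[R]_n.+1 -> R) (X Y : vector_field R n),
      smooth_on M h -> smooth_on M X -> smooth_on M Y ->
      forall p, M p ->
        nabla (fun q => h q *: X q) Y p = h p *: nabla X Y p;
    connection_addr : forall X Y1 Y2 : vector_field R n,
      smooth_on M X -> smooth_on M Y1 -> smooth_on M Y2 ->
      forall p, M p ->
        nabla X (fun q => Y1 q + Y2 q) p = nabla X Y1 p + nabla X Y2 p;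
    connection_leibniz : forall (h : 'rV[R]_n.+1 -> R) (X Y : vector_field R n),
      smooth_on M h -> smooth_on M X -> smooth_on M Y ->
      forall p, M p ->
        nabla X (fun q => h q *: Y q) p
          = 'D_(X p) h p *: Y p + h p *: nabla X Y p
  }.

Definition torsion_free (R : realType) (n : nat) (M : set 'rV[R]_n.+1)
    (nabla : vector_field R n -> vector_field R n -> vector_field R n) : Prop :=
  forall X Y : vector_field R n, smooth_on M X -> smooth_on M Y ->
    forall p, M p -> nabla X Y p - nabla Y X p = lie_bracket X Y p.

Definition metric_compatible (R : realType) (n : nat) (M : set 'rV[R]_n.+1)
    (g : metric_tensor R n)
    (nabla : vector_field R n -> vector_field R n -> vector_field R n) : Prop :=
  forall X Y Z : vector_field R n,
    smooth_on M X -> smooth_on M Y -> smooth_on M Z ->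
    forall p, M p ->
      'D_(X p) (fun q => inner g q (Y q) (Z q)) p
        = inner g p (nabla X Y p) (Z p) + inner g p (Y p) (nabla X Z p).

Definition levi_civita (R : realType) (n : nat) (M : set 'rV[R]_n.+1)
    (g : metric_tensor R n)
    (nabla : vector_field R n -> vector_field R n -> vector_field R n) : Prop :=
  [/\ affine_connection M nabla, torsion_free M nabla
    & metric_compatible M g nabla].

Definition coord_field (R : realType) (n : nat) (i : 'I_n.+1) :
    vector_field R n :=
  fun=> basis_vec R i.

(** The covariant derivative along [c] of a field [V] along [c]. Writing
    [V = sum_j V^j d_j], the axioms of a covariant derivative along a curve give
    [sum_j (V^j)' d_j + sum_(i,j) (c^i)' V^j nabla_(d_i) d_j]. *)
Definition covariant_along (R : realType) (n : nat)
    (nabla : vector_field R n -> vector_field R n -> vector_field R n)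
    (c V : R -> 'rV[R]_n.+1) (t : R) : 'rV[R]_n.+1 :=
  derive1 V t + \sum_(i < n.+1) \sum_(j < n.+1)
    (derive1 c t 0 i * V t 0 j) *:
      nabla (@coord_field R n i) (@coord_field R n j) (c t).

Definition geodesic (R : realType) (n : nat) (M : set 'rV[R]_n.+1)
    (nabla : vector_field R n -> vector_field R n -> vector_field R n)
    (I : set R) (c : R -> 'rV[R]_n.+1) : Prop :=
  [/\ smooth_curve_on I c,
      (forall t, I t -> M (c t))
    & forall t, I t -> covariant_along nabla c (derive1 c) t = 0].

(** * The Riemannian manifold of an autonomous second-order ODE *)

(** Points of J^1(R,R) are row vectors [(x, u, u1)]. *)
Definition jet_point (R : realType) (x u u1 : R) : 'rV[R]_3 :=
  \row_(i < 3) nth 0 [:: x; u; u1] i.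

Definition jet_u (R : realType) (p : 'rV[R]_3) : R := p 0 (inord 1).
Definition jet_u1 (R : realType) (p : 'rV[R]_3) : R := p 0 (inord 2).

Definition prolongation (R : realType) (f : R -> R) (x : R) : 'rV[R]_3 :=
  jet_point x (f x) (derive1 f x).

(** A function on [U] depending only on [(u, u1)] is given as a function of two
    variables pulled back to the jet space; [U] need not be a product. *)
Definition on_jets (R : realType) (phi : R -> R -> R) (p : 'rV[R]_3) : R :=
  phi (jet_u p) (jet_u1 p).

Definition ode_manifold (R : realType) (U : set 'rV[R]_3) : set 'rV[R]_3 :=
  [set p | U p /\ jet_u1 p != 0].

Definition ode_metric (R : realType) (phi : R -> R -> R) : metric_tensor R 2 :=
  fun p =>
    let u1 := jet_u1 p in
    let a := on_jets phi p in
    \matrix_(i < 3, j < 3) nth 0 (nth [::]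
      [:: [:: 1 + u1 ^+ 2 ; - u1                      ; 0         ];
          [:: - u1        ; 1 + a ^+ 2 / u1 ^+ 2      ; - (a / u1)];
          [:: 0           ; - (a / u1)                ; 1         ] ] i) j.

Definition ode_solution (R : realType) (phi : R -> R -> R) (I : set R)
    (f : R -> R) : Prop :=
  forall x, I x -> derive1n 2 f x = phi (f x) (derive1 f x).

(** The metric is the sum of the squares of the coframe
    [dx], [- u1 dx + du], [- (phi / u1) du + du1]. *)
Definition ode_coframe (R : realType) (phi : R -> R -> R) (p v : 'rV[R]_3)
    (k : 'I_3) : R :=
  nth 0 [:: v 0 (inord 0);
            - jet_u1 p * v 0 (inord 0) + v 0 (inord 1);
            - (on_jets phi p / jet_u1 p) * v 0 (inord 1) + v 0 (inord 2)] k.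

Lemma ode_metric_coframe (R : realType) (phi : R -> R -> R)
    (p v w : 'rV[R]_3) :
  inner (ode_metric phi) p v w
    = \sum_(k < 3) ode_coframe phi p v k * ode_coframe phi p w k.
Proof.
have E (k : nat) (hk : (k < 3)%N) (i : 'I_3) : val i = k -> i = inord k.
  by move=> <-; rewrite inord_val.
rewrite /inner !mxE !big_ord_recl !big_ord0 !mxE !big_ord_recl !big_ord0 !mxE /=.
rewrite /ode_coframe /=.
rewrite (E 2%N isT (lift ord0 (lift ord0 ord0)) erefl).
rewrite (E 1%N isT (lift ord0 ord0) erefl) -(E 0%N isT ord0 erefl).
rewrite -exprVn; ring.
Qed.

(* Main.v *)
Require Import Defs.
From HB Require Import structures.
From mathcomp Require Import all_boot all_order all_algebra.
From mathcomp Require Import all_classical all_reals all_analysis.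
From mathcomp Require Import ring lra.

Import Order.TTheory GRing.Theory Num.Theory.
Import numFieldNormedType.Exports.

Local Open Scope classical_set_scope.
Local Open Scope ring_scope.

(** Prolonged solutions are integral curves of the field
    [T = d_x + u1 d_u + phi d_u1], whose coframe components are [(1, 0, 0)], so
    that [g(T, -) = dx] and, [dx] being closed, [nabla_T T = 0]. To see this with
    constant fields only, take [v = T(p)]: metric compatibility and the absence of
    torsion give [2 g(nabla_v v, w) = 2 D_v g(v, w) - D_w g(v, v)], and the right
    hand side is [- 2 g(a, w)] for [a = (0, phi, T phi)]. Along a prolonged
    solution [a] is the second derivative of the curve, by the chain rule for
    [phi], which is differentiable because its partial derivatives are
    continuous. *)

(** * Differentiability from continuous partial derivatives *)

(** Since [f] is known to be derivable only in the direction [v] at one point, the chain rule is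
    applied to the one-variable function [G], recentred at that point, composed with
    [t |-> a * (t - s)]. *)
Lemma is_derive_line {R : realType} {V : normedModType R} (f : V -> R)
    (x v : V) (a s : R) :
  derivable f (x + (a * s) *: v) v ->
  is_derive s 1 (fun t => f (x + (a * t) *: v)) (a * 'D_v f (x + (a * s) *: v)).
Proof.
set y := x + _; set G : R -> R := fun h => f (h *: v + y).
move=> /derivable1P df.
have DG : 'D_1 G 0 = 'D_v f y.
  rewrite /derive; set d := (fun _ : R => _); set d' := (fun _ : R => _).
  suff -> : d = d' by []; apply/funext => h.
  by rewrite /d /d' /G /= addr0 scale0r add0r [_%:A]mulr1.
have dr : is_derive s (1 : R) (a *: (id - cst s) : R -> R) (a *: (1 - 0)) by exact _.
have -> : (fun t => f (x + (a * t) *: v)) = G \o (a *: (id - cst s)).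
  apply/funext => t /=; rewrite /G /y addrC -[RHS]/(f (_ *: v + _)).
  rewrite addrCA -scalerDl -[(a *: (id - cst s)) t]/(a * (t - s)).
  by rewrite addrC; congr (f (_ + _ *: _)); ring.
have dG : is_derive ((a *: (id - cst s) : R -> R) s) 1 G ('D_v f y).
  rewrite -[(a *: (id - cst s)) s]/(a * (s - s)) subrr mulr0 -DG.
  exact: derivableP.
have -> : a * 'D_v f y = 'D_v f y * (a *: (1 - 0)).
  by rewrite subr0 /GRing.scale /= mulr1 mulrC.
exact: is_derive1_comp.
Qed.

(** Parametrising the segment by [[0, 1]] and keeping [a] as a factor avoids a case split on the
    sign of [a]. *)
Lemma derivable_mean_value {R : realType} {V : normedModType R} (f : V -> R)
    (x v : V) (a : R) :
  (forall s : R, 0 <= s <= 1 -> derivable f (x + (a * s) *: v) v) ->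
  exists2 s, 0 <= s <= 1 &
    f (x + a *: v) - f x = a * 'D_v f (x + (a * s) *: v).
Proof.
move=> df.
have dF (s : R) : 0 <= s <= 1 -> is_derive s 1 (fun t => f (x + (a * t) *: v))
    (a * 'D_v f (x + (a * s) *: v)).
  by move=> /df; exact: is_derive_line.
have F' (s : R) : s \in `]0, 1[%R -> is_derive s 1 (fun t => f (x + (a * t) *: v))
    (a * 'D_v f (x + (a * s) *: v)).
  by rewrite in_itv => /andP[/ltW s0 /ltW s1]; apply: dF; rewrite s0.
have Fc : {within `[0, 1], continuous (fun t => f (x + (a * t) *: v))}.
  apply: derivable_within_continuous => s; rewrite in_itv => s01.
  by have [] := dF s s01.
have [s] := MVT_segment ler01 F' Fc.
rewrite in_itv => s01; rewrite mulr1 mulr0 scale0r addr0 subr0 mulr1 => E.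
by exists s.
Qed.

Lemma coord_le_mx_norm {R : realFieldType} {m n} (A : 'M[R]_(m, n)) i j :
  `|A i j| <= `|A|.
Proof.
rewrite [leRHS]/Num.Def.normr/= mx_normrE.
exact: (le_bigmax _ (fun ij => `|A ij.1 ij.2|) (i, j)).
Qed.

Lemma mx_norm_le {R : realFieldType} {m n} (A : 'M[R]_(m, n)) e :
  0 <= e -> (forall i j, `|A i j| <= e) -> `|A| <= e.
Proof.
by move=> e0 Ae; rewrite /Num.Def.normr/= mx_normrE (bigmax_le _ e0).
Qed.

(** The estimate is a little-o expansion of [f] at [x]; uniqueness of such expansions identifies
    [df] with the differential ['d f x]. *)
Lemma differentiable_approx {R : numFieldType} {V W : normedModType R}
    (f : V -> W) (df : {linear V -> W}) (x : V) :
  continuous df ->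
  (forall e, 0 < e ->
    \forall v \near 0, `|f (v + x) - f x - df v| <= e * `|v|) ->
  differentiable f x.
Proof.
move=> cdf fdf.
have fo : f \o shift x = cst (f x) + df +o_ 0 id.
  apply/eqaddoP => e e0; have := fdf e e0; apply: filterS => v.
  rewrite -![(_ + _ : _ -> _) _]/(_ + _) -![(- _ : _ -> _) _]/(- _).
  by rewrite -![(_ + _ : _ -> _) _]/(_ + _) /= opprD addrA.
by apply/diff_locallyP; rewrite (diff_unique cdf fo).
Qed.

Section continuous_partials.
Context {R : realType} {n : nat} (f : 'rV[R]_n.+1 -> R) (p : 'rV[R]_n.+1).

(* Interpolates between [p] and [p + v], changing one coordinate at a time. *)
Let corner (v : 'rV[R]_n.+1) (k : nat) : 'rV[R]_n.+1 :=
  p + \row_i (if (i < k)%N then v 0 i else 0).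

Let cornerS v (i : 'I_n.+1) :
  corner v i.+1 = corner v i + v 0 i *: basis_vec R i.
Proof.
rewrite /corner -addrA; congr (_ + _); apply/rowP => j; rewrite !mxE eqxx /=.
rewrite ltnS leq_eqVlt eq_sym -val_eqE /=.
by case: eqVneq => [/val_inj ->|]; rewrite ?ltnn ?mulr1 ?mulr0 ?add0r ?addr0.
Qed.

(** The norm is the maximum of the coordinates, and each coordinate of the difference is [0], a
    coordinate of [v], or [s] times one. *)
Let corner_near v (i : 'I_n.+1) (s : R) : 0 <= s <= 1 ->
  `|corner v i + (v 0 i * s) *: basis_vec R i - p| <= `|v|.
Proof.
move=> /andP[s0 s1]; apply: mx_norm_le => // k j; rewrite ord1 {k} !mxE eqxx /=.
rewrite addrAC (addrC (p 0 j)) addrK.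
case: eqVneq => [->|_]; last first.
  by rewrite mulr0 addr0; case: ifP; rewrite ?normr0 // coord_le_mx_norm.
rewrite ltnn add0r mulr1 normrM (ger0_norm s0).
by rewrite (le_trans (ler_piMr _ _)) // coord_le_mx_norm.
Qed.

(** The increment of [f] telescopes along the corners from [p] to [p + v]. By the mean value theorem
    the [i]-th term is [v 0 i] times an [i]-th partial derivative taken within [|v|] of [p], hence
    close to its value at [p]. *)
Lemma differentiable_continuous_partials :
  (\forall q \near p, forall i, derivable f q (basis_vec R i)) ->
  (forall i, {for p, continuous (fun q => 'D_(basis_vec R i) f q)}) ->
  differentiable f p.
Proof.
move=> df cf.
pose L (v : 'rV[R]_n.+1) : R := \sum_i v 0 i * 'D_(basis_vec R i) f p.
have linL : linear L.
  move=> a u v; rewrite /L scaler_sumr -big_split; apply: eq_bigr => i _.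
  by rewrite !mxE mulrDl -mulrA.
pose linLM := GRing.isLinear.Build _ _ _ _ _ linL.
pose LL : {linear _ -> _} := HB.pack L linLM.
have cL : continuous L.
  apply: continuous_big => [|i _ v]; first exact: add_continuous.
  apply: (@continuousM _ _ (fun w : 'rV[R]_n.+1 => w 0 i) (cst _)).
    exact: coord_continuous.
  exact: cst_continuous.
apply: (@differentiable_approx _ _ _ f LL) => // _/posnumP[e].
(* The error [e] is shared equally among the [n.+1] coordinates. *)
pose e' := e%:num / n.+1%:R.
have e'0 : 0 < e' by rewrite divr_gt0.
have /(@filter_forall _ _ _ _ (nbhs_filter p)) cf' (i : 'I_n.+1) :
    \forall q \near p,
    `|'D_(basis_vec R i) f p - 'D_(basis_vec R i) f q| <= e'.
  by have /cvgrPdist_le /(_ _ e'0) := cf i; exact.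
have /nbhs_ballP[d /= d0 dP] : \forall q \near p, forall i,
    derivable f q (basis_vec R i) /\
    `|'D_(basis_vec R i) f p - 'D_(basis_vec R i) f q| <= e'.
  by apply: filterS2 df cf' => q dq cq i; split.
near=> v.
have vd : `|v| < d by near: v; apply: (@nbhs0_lt R 'rV[R]_n.+1).
  have -> : f (v + p) - f p = \sum_(i < n.+1) (f (corner v i.+1) - f (corner v i)).
  rewrite -(big_mkord xpredT (fun i => f (corner v i.+1) - f (corner v i))).
  rewrite telescope_sumr //; congr (f _ - f _); apply/rowP => i; rewrite !mxE.
    by rewrite ltn_ord addrC.
  by rewrite addr0.
rewrite /L -sumrB (le_trans (ler_norm_sum _ _ _)) //.
have -> : e%:num * `|v| = \sum_(i < n.+1) e' * `|v|.
  by rewrite sumr_const card_ord -mulr_natr /e'; field.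
apply: ler_sum => i _; rewrite cornerS.
have inb (s : R) : 0 <= s <= 1 ->
    ball p d (corner v i + (v 0 i * s) *: basis_vec R i).
  move=> s01; rewrite -ball_normE /= distrC.
  by apply: le_lt_trans vd; exact: corner_near.
have [s s01 ->] : exists2 s, 0 <= s <= 1 &
    f (corner v i + v 0 i *: basis_vec R i) - f (corner v i) =
    v 0 i * 'D_(basis_vec R i) f (corner v i + (v 0 i * s) *: basis_vec R i).
  by apply: derivable_mean_value => s s01; have /dP /(_ i)[] := inb s s01.
rewrite -mulrBr normrM mulrC ler_pM // ?coord_le_mx_norm // distrC.
by have /dP /(_ i)[] := inb s s01.
Unshelve. all: by end_near. Qed.

End continuous_partials.

(** * Connections evaluated on constant fields *)

Lemma innerDl {R : realType} {n : nat} (g : metric_tensor R n)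
    (p u v w : 'rV[R]_n.+1) :
  inner g p (u + v) w = inner g p u w + inner g p v w.
Proof. by rewrite /inner !mulmxDl mxE. Qed.

Lemma smooth_on_cst {R : realType} {n : nat} {V : normedModType R}
    (A : set 'rV[R]_n.+1) (v : V) :
  smooth_on A (fun=> v).
Proof.
move=> s p _.
have [w ->] : exists w : V, iter_partial s (fun=> v) = cst w.
  elim: s => [|i s [w IH]]; first by exists v.
  by exists 0; apply/funext => q; rewrite /= IH derive_cst.
by split => [|i]; [exact: cst_continuous|exact: derivable_cst].
Qed.

Section constant_fields.
Context {R : realType} {n : nat} {M : set 'rV[R]_n.+1}.
Context {nabla : vector_field R n -> vector_field R n -> vector_field R n}.
Hypothesis conn : affine_connection M nabla.

(** On constant fields [nabla] is bilinear over [R], because the derivative term of the Leibniz rule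
    vanishes for a constant factor. This collapses the double sum in [covariant_along]. *)
Lemma connection_cstE (v w p : 'rV[R]_n.+1) : M p ->
  nabla (fun=> v) (fun=> w) p = \sum_(i < n.+1) \sum_(j < n.+1)
    (v 0 i * w 0 j) *: nabla (@coord_field R n i) (@coord_field R n j) p.
Proof.
move=> Mp; have sm (u : 'rV[R]_n.+1) : smooth_on M (fun=> u).
  exact: smooth_on_cst.
have sc (a : R) : smooth_on M (fun=> a) by exact: smooth_on_cst.
have Zl a u u' : nabla (fun=> a *: u) (fun=> u') p =
    a *: nabla (fun=> u) (fun=> u') p.
  exact: (connection_scalel conn (sc a) (sm u) (sm u') Mp).
have Zr a u u' : nabla (fun=> u) (fun=> a *: u') p =
    a *: nabla (fun=> u) (fun=> u') p.
  rewrite (connection_leibniz conn (sc a) (sm u) (sm u') Mp).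
  by rewrite derive_cst scale0r add0r.
have zl u' : nabla (fun=> 0) (fun=> u') p = 0.
  by have := Zl 0 0 u'; rewrite !scale0r.
have zr u : nabla (fun=> u) (fun=> 0) p = 0.
  by have := Zr 0 u 0; rewrite !scale0r.
have Dl u' : {morph (fun u => nabla (fun=> u) (fun=> u') p) : x y / x + y}.
  by move=> x y; exact: (connection_addl conn (sm x) (sm y) (sm u') Mp).
have Dr u : {morph (fun u' => nabla (fun=> u) (fun=> u') p) : x y / x + y}.
  by move=> x y; exact: (connection_addr conn (sm u) (sm x) (sm y) Mp).
rewrite {1}(row_sum_delta v) (big_morph _ (Dl w) (zl w)).
apply: eq_bigr => i _; rewrite Zl {1}(row_sum_delta w).
rewrite (big_morph _ (Dr (delta_mx 0 i)) (zr _)) scaler_sumr.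
by apply: eq_bigr => j _; rewrite Zr scalerA.
Qed.

End constant_fields.

(** This is the Koszul formula for constant fields, whose Lie brackets vanish. Symmetry of [g] at
    [p] is a separate hypothesis, as [metric_tensor] does not include it. *)
Lemma levi_civita_cst {R : realType} {n : nat} {M : set 'rV[R]_n.+1}
    {g : metric_tensor R n} {nabla} (v w p : 'rV[R]_n.+1) :
  levi_civita M g nabla -> M p ->
  (forall u u', inner g p u u' = inner g p u' u) ->
  2 * inner g p (nabla (fun=> v) (fun=> v) p) w =
    2 * 'D_v (fun q => inner g q v w) p - 'D_w (fun q => inner g q v v) p.
Proof.
move=> [_ tf mc] Mp gC.
have sm (u : 'rV[R]_n.+1) : smooth_on M (fun=> u) by exact: smooth_on_cst.
have E : nabla (fun=> v) (fun=> w) p = nabla (fun=> w) (fun=> v) p.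
  apply/eqP; rewrite -subr_eq0 (tf _ _ (sm v) (sm w) p Mp).
  by rewrite /lie_bracket !derive_cst subrr.
rewrite (mc _ _ _ (sm v) (sm v) (sm w) p Mp).
rewrite (mc _ _ _ (sm w) (sm v) (sm v) p Mp) -E gC [in X in _ - X]gC.
by rewrite [inner g p w _]gC; ring.
Qed.

Lemma covariant_along_velocity {R : realType} {n : nat} {M : set 'rV[R]_n.+1}
    {nabla} (c : R -> 'rV[R]_n.+1) (t : R) :
  affine_connection M nabla -> M (c t) ->
  covariant_along nabla c (derive1 c) t =
    derive1 (derive1 c) t +
    nabla (fun=> derive1 c t) (fun=> derive1 c t) (c t).
Proof. by move=> conn Mc; rewrite /covariant_along (connection_cstE conn). Qed.

(** In [smooth_on], the empty sequence provides the partial derivatives near [p] and the singletons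
    provide their continuity at [p]. *)
Lemma smooth_differentiable {R : realType} {n : nat} {A : set 'rV[R]_n.+1}
    (h : 'rV[R]_n.+1 -> R) (p : 'rV[R]_n.+1) :
  open A -> smooth_on A h -> A p -> differentiable h p.
Proof.
move=> oA sh Ap; apply: differentiable_continuous_partials.
  have A' : \forall q \near p, A q by exact: open_nbhs_nbhs.
  by apply: filterS A' => q Aq i; have [_] := sh [::] q Aq; apply.
by move=> i; have [] := sh [:: i] p Ap.
Qed.

Lemma is_derive_coord {R : realType} {n : nat} (i : 'I_n.+1)
    (p v : 'rV[R]_n.+1) :
  is_derive p v (fun q : 'rV[R]_n.+1 => q 0 i : R) (v 0 i).
Proof.
have /derivable_mxP/(_ 0 i) dp := @derivable_id R 'rV[R]_n.+1 p v.
apply: DeriveDef => //; have := derive_id p v.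
by move/rowP/(_ i) => <-; rewrite derive_mx ?mxE //; exact: derivable_id.
Qed.

(** * Derivatives of the metric of the ODE *)

Section ode_metric.
Context {R : realType} (phi : R -> R -> R) (p : 'rV[R]_3).
Hypotheses (p_neq0 : jet_u1 p != 0) (dphi : differentiable (on_jets phi) p).

Let slope (q : 'rV[R]_3) : R := on_jets phi q / jet_u1 q.

Lemma ode_metricE (q v w : 'rV[R]_3) : inner (ode_metric phi) q v w =
  v 0 (inord 0) * w 0 (inord 0)
  + (- jet_u1 q * v 0 (inord 0) + v 0 (inord 1))
    * (- jet_u1 q * w 0 (inord 0) + w 0 (inord 1))
  + (- slope q * v 0 (inord 1) + v 0 (inord 2))
    * (- slope q * w 0 (inord 1) + w 0 (inord 2)).
Proof.
by rewrite ode_metric_coframe !big_ord_recl big_ord0 addr0 addrA.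
Qed.

Lemma ode_metricC (q v w : 'rV[R]_3) :
  inner (ode_metric phi) q v w = inner (ode_metric phi) q w v.
Proof. by rewrite !ode_metricE; ring. Qed.

(** Taking [w = v] gives a sum of three squares. The coframe is triangular, so the coordinates of
    [v] vanish one after the other. *)
Lemma ode_metric_nondegenerate (v : 'rV[R]_3) :
  (forall w, inner (ode_metric phi) p v w = 0) -> v = 0.
Proof.
move=> /(_ v); rewrite ode_metricE -!expr2 => /eqP.
rewrite paddr_eq0 ?addr_ge0 ?sqr_ge0 // paddr_eq0 ?sqr_ge0 //.
rewrite !sqrf_eq0 => /andP[/andP[/eqP v0]].
rewrite v0 mulr0 add0r => /eqP v1; rewrite v1 mulr0 add0r => /eqP v2.
apply/rowP => i; rewrite mxE -(inord_val i).
by case: i => -[|[|[|//]]] /= _.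
Qed.

Let derive_inner (v w u : 'rV[R]_3) :
  'D_u (fun q => inner (ode_metric phi) q v w) p =
  - u 0 (inord 2) * v 0 (inord 0) * (- jet_u1 p * w 0 (inord 0) + w 0 (inord 1))
  + (- jet_u1 p * v 0 (inord 0) + v 0 (inord 1)) * (- u 0 (inord 2) * w 0 (inord 0))
  - 'D_u slope p * v 0 (inord 1) * (- slope p * w 0 (inord 1) + w 0 (inord 2))
  - (- slope p * v 0 (inord 1) + v 0 (inord 2)) * ('D_u slope p * w 0 (inord 1)).
Proof.
have du1 : is_derive p u (@jet_u1 R) (u 0 (inord 2)) := is_derive_coord _ p u.
have ds : is_derive p u slope ('D_u slope p).
  apply: derivableP; apply: derivableM; first exact: diff_derivable.
  by apply: derivableV => //; exact: ex_derive.
(* Written with the ring operations on functions, the metric has a derivative that [derive_val]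
   computes by instance search; these operations are then evaluated at [p] for [ring]. *)
have -> : (fun q => inner (ode_metric phi) q v w) =
  cst (v 0 (inord 0) * w 0 (inord 0))
  + (- @jet_u1 R * cst (v 0 (inord 0)) + cst (v 0 (inord 1)))
    * (- @jet_u1 R * cst (w 0 (inord 0)) + cst (w 0 (inord 1)))
  + (- slope * cst (v 0 (inord 1)) + cst (v 0 (inord 2)))
    * (- slope * cst (w 0 (inord 1)) + cst (w 0 (inord 2))).
  by apply/funext => q; rewrite ode_metricE.
rewrite derive_val.
rewrite -![(_ + _ : _ -> _) _]/(_ + _) -![(_ * _ : _ -> _) _]/(_ * _).
rewrite -![(- _ : _ -> _) _]/(- _) /cst /GRing.scale /=.
ring.
Qed.

Let derive_slope (u : 'rV[R]_3) : 'D_u slope p =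
  ('D_u (on_jets phi) p - slope p * u 0 (inord 2)) / jet_u1 p.
Proof.
have du1 : is_derive p u (@jet_u1 R) (u 0 (inord 2)) := is_derive_coord _ p u.
rewrite /slope deriveM; last 2 first.
- exact: diff_derivable.
- by apply: derivableV => //; exact: ex_derive.
rewrite (deriveV p_neq0 (@ex_derive _ _ _ _ _ _ _ du1)) derive_val.
by rewrite /GRing.scale /=; field.
Qed.

(* Freeze the components of [T] at [p]: since [T] is killed by the last two
   coframe forms at [p], [g(T, T) - 1] vanishes there to second order, and only
   the derivatives of those two forms along [T] contribute. *)
Lemma ode_metric_acceleration (w : 'rV[R]_3) :
  let T := jet_point 1 (jet_u1 p) (on_jets phi p) in
  2 * 'D_T (fun q => inner (ode_metric phi) q T w) p
    - 'D_w (fun q => inner (ode_metric phi) q T T) p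
  = - 2 * inner (ode_metric phi) p
            (jet_point 0 (on_jets phi p) ('D_T (on_jets phi) p)) w.
Proof.
move=> T.
have T0 : T 0 (inord 0) = 1 by rewrite mxE inordK.
have T1 : T 0 (inord 1) = jet_u1 p by rewrite mxE inordK.
have T2 : T 0 (inord 2) = on_jets phi p by rewrite mxE inordK.
rewrite !derive_inner ode_metricE !derive_slope T0 T1 T2.
set A := jet_point 0 _ _.
have -> : A 0 (inord 0) = 0 by rewrite mxE inordK.
have -> : A 0 (inord 1) = on_jets phi p by rewrite mxE inordK.
have -> : A 0 (inord 2) = 'D_T (on_jets phi) p by rewrite mxE inordK.
by rewrite /slope; field.
Qed.

End ode_metric.

(** * Smooth curves and prolongations *)

Lemma derive1_near_eq {R : realType} {V : normedModType R} (f g : R -> V) t :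
  (\near t, f t = g t) -> derive1 f t = derive1 g t.
Proof. by move=> fg; rewrite !derive1E; exact: near_eq_derive. Qed.

Lemma derive1_mx {R : realType} {m n : nat} (c : R -> 'M[R]_(m, n)) t i j :
  derivable c t 1 -> derive1 c t i j = derive1 (fun s => c s i j) t.
Proof. by move=> dc; rewrite !derive1E (derive_mx dc) mxE. Qed.

Lemma smooth_curve_on_mx {R : realType} {m n : nat} {I : set R}
    (c : R -> 'M[R]_(m, n)) :
  open I -> (forall i j, smooth_curve_on I (fun t => c t i j)) ->
  smooth_curve_on I c.
Proof.
move=> oI sc.
(* Derivatives can be taken entrywise only where the curve is derivable, so both facts go through
   one induction; openness of [I] lets an equality on [I] be differentiated. *)
suff H k t : I t -> derivable (derive1n k c) t 1 /\
    forall i j, derive1n k c t i j = derive1n k (fun s => c s i j) t.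
  by move=> k t /(H k)[].
elim: k t => [|k IH] t It.
  by split => //; apply/derivable_mxP => i j; exact: (sc i j 0%N t It).
have It' : \forall s \near t, I s by exact: open_nbhs_nbhs.
have E s : I s -> forall i j,
    derive1n k.+1 c s i j = derive1n k.+1 (fun s => c s i j) s.
  move=> Is i j; rewrite !derive1nS derive1_mx; last by have [] := IH s Is.
  apply: derive1_near_eq.
  have Is' : \forall s \near s, I s by exact: open_nbhs_nbhs.
  by apply: filterS Is' => r Ir; have [] := IH r Ir.
split; last exact: E.
apply/derivable_mxP => i j; apply: near_eq_derivable (sc i j k.+1 t It).
by apply: filterS It' => s Is; rewrite E.
Qed.

Lemma smooth_curve_on_id {R : realType} (I : set R) :
  smooth_curve_on I (id : R -> R).
Proof.
case=> [|k] t _; first exact: derivable_id.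
suff [a ->] : exists a : R, derive1n k.+1 (id : R -> R) = cst a.
  exact: derivable_cst.
elim: k => [|k [a IH]].
  by exists 1; apply/funext => s; rewrite derive1n1 derive1_id.
by exists 0; apply/funext => s; rewrite derive1nS IH derive1_cst.
Qed.

Lemma smooth_curve_on_derive1 {R : realType} {V : normedModType R} {I : set R}
    (f : R -> V) : smooth_curve_on I f -> smooth_curve_on I (derive1 f).
Proof. by move=> sf k t It; rewrite -derive1Sn; exact: sf. Qed.

Section prolongation.
Context {R : realType} {I : set R} {f : R -> R}.
Hypotheses (I_open : open I) (f_smooth : smooth_curve_on I f).

Lemma smooth_prolongation : smooth_curve_on I (prolongation f).
Proof.
apply: (@smooth_curve_on_mx R 1 3 I (prolongation f) I_open) => i j.
(* The default [cst 0] is never reached, since [j < 3]. *)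
have -> : (fun t => prolongation f t i j) = nth (cst 0) [:: id; f; derive1 f] j.
  by apply/funext => t; rewrite mxE; case: j => -[|[|[|]]].
case: j => -[ltj|[ltj|[ltj|k ltj]]]; last by discriminate ltj.
- exact: (@smooth_curve_on_id R I).
- exact: f_smooth.
- exact: (@smooth_curve_on_derive1 R R I f f_smooth).
Qed.

Lemma derive1_prolongation t : I t ->
  derive1 (prolongation f) t = jet_point 1 (derive1 f t) (derive1n 2 f t).
Proof.
move=> It; apply/rowP => j; rewrite derive1_mx; last first.
  exact: (smooth_prolongation 0%N t It).
have -> : (fun t => prolongation f t 0 j) = nth (cst 0) [:: id; f; derive1 f] j.
  by apply/funext => s; rewrite mxE; case: j => -[|[|[|]]].
rewrite mxE; case: j => -[|[|[|//]]] /= _ //; exact: derive1_id.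
Qed.

Lemma derive1n2_prolongation t : I t ->
  derive1 (derive1 (prolongation f)) t =
    jet_point 0 (derive1n 2 f t) (derive1n 3 f t).
Proof.
move=> It; have It' : \forall s \near t, I s by exact: open_nbhs_nbhs.
apply/rowP => j; rewrite derive1_mx; last exact: (smooth_prolongation 1%N t It).
rewrite (@derive1_near_eq _ _ _
    (nth (cst 0) [:: cst 1; derive1 f; derive1n 2 f] j)); last first.
  apply: filterS It' => s Is; rewrite derive1_prolongation // mxE.
  by case: j => -[|[|[|]]].
rewrite mxE; case: j => -[|[|[|//]]] /= _ //; exact: derive1_cst.
Qed.

End prolongation.

(** * The geodesic equation along a prolonged solution *)

Theorem mainTheorem2 (R : realType) (U : set 'rV[R]_3) (phi : R -> R -> R)
    (U_open : open U) (phi_smooth : smooth_on U (on_jets phi))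
    (nabla : vector_field R 2 -> vector_field R 2 -> vector_field R 2)
    (nabla_LC : levi_civita (ode_manifold U) (ode_metric phi) nabla)
    (I : set R) (I_open : open I) (I_itv : is_interval I)
    (f : R -> R) (f_smooth : smooth_curve_on I f)
    (f_in_M : forall x, I x -> ode_manifold U (prolongation f x))
    (f_sol : ode_solution phi I f) :
  geodesic (ode_manifold U) nabla I (prolongation f).
Proof.
split=> [||t It]; [exact: smooth_prolongation|exact: f_in_M|].
have [conn _ _] := nabla_LC.
have Mt := f_in_M t It; have [Ut u1_neq0] := Mt.
rewrite (covariant_along_velocity _ _ conn Mt).
set p := prolongation f t in Mt Ut u1_neq0 *.
have dphi : differentiable (on_jets phi) p by exact: smooth_differentiable Ut.
have jet_u_prolongation s : jet_u (prolongation f s) = f s.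
  by rewrite /jet_u mxE inordK.
have jet_u1_prolongation s : jet_u1 (prolongation f s) = derive1 f s.
  by rewrite /jet_u1 mxE inordK.
have f2E s : I s -> derive1n 2 f s = on_jets phi (prolongation f s).
  by move=> Is; rewrite f_sol // /on_jets jet_u_prolongation jet_u1_prolongation.
set T := jet_point 1 (jet_u1 p) (on_jets phi p).
have velocity : derive1 (prolongation f) t = T.
  by rewrite (derive1_prolongation I_open f_smooth) // f2E // -jet_u1_prolongation.
(* The equation is differentiated along the curve: it holds on a neighbourhood of [t], and the chain
   rule applies with velocity [T]. *)
have f3E : derive1n 3 f t = 'D_T (on_jets phi) p.
  have It' : \forall s \near t, I s by exact: open_nbhs_nbhs.
  rewrite [LHS](@derive1_near_eq _ _ _ (on_jets phi \o prolongation f)); last first.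
    by apply: filterS It' => s; exact: f2E.
  have dc : differentiable (prolongation f) t.
    apply/derivable1_diffP.
    exact: (smooth_prolongation I_open f_smooth 0%N t It).
  rewrite derive1E'; last exact: differentiable_comp.
  by rewrite diff_comp //= -(derive1E' dc) velocity deriveE.
rewrite (derive1n2_prolongation I_open f_smooth) // f2E // f3E velocity.
(* Paired with any [w], the acceleration and [nabla] of the constant field [T] along itself
   cancel. *)
apply: (ode_metric_nondegenerate phi p) => w.
have := levi_civita_cst T w p nabla_LC Mt (ode_metricC phi p).
rewrite (ode_metric_acceleration phi p u1_neq0 dphi w) innerDl => lc; lra.
Qed.
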